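(* For all integers $n,f$ with $1\le f\le n-1$, $\mathrm{Cons}(n,f)$ is not $C$-reducible to $\mathrm{Cons}(n+1,f)$.
   Context: Model: a finite set of processes runs an asynchronous algorithm communicating by reliable message passing with unbounded delays and speeds; processes fail only by crashing. Time is $\mathcal T=\mathbb N$; a failure pattern $F$ for $\Pi$ is a nondecreasing map $\mathcal T\to2^\Pi$, $Faulty(F)=\bigcup_tF(t)$. A task $T=(P,f)$ consists of a binary agreement problem $P$ (mapping $(F,\vec V)$, $\vec V\in\{0,1\}^\Pi$, to a nonempty $P(F,\vec V)\subseteq\{0,1\}$) and a resiliency degree $f$. An algorithm solves $T$ if in every run with $|Faulty(F)|\le f$ and initial values $\vec V$: every correct process eventually decides, decisions are irrevocable, no two processes decide differently, and decisions lie in $P(F,\vec V)$. Binary Consensus $\mathrm{Cons}(n,f)=(\mathrm{Cons}_{\Pi},f)$ on $\Pi=\{1,\dots,n\}$: $\mathrm{Cons}_\Pi(F,\vec V)=\{v\}$ if all entries of $\vec V$ equal $v$, and $\{0,1\}$ otherwise. Oracles: for $T=(P,f)$ on process set $\Pi'$, $\mathcal O.T$ is a black box with consultants $\Pi'$; its history is a sequence of successive consultations, in each of which every consultant may submit at most one query in $\{0,1\}$ and the oracle returns a common response $d$ with $d\in P(F,\vec V)$ for every $\vec V$ extending the partial query vector (the oracle may use the whole failure pattern, including future crashes), and every correct querier gets the response whenever at least $|\Pi'|-f$ consultants query; $\mathcal O.T$ is the most general such oracle. $C$-reduction: $T_1\le_C T_2$ if there is an algorithm solving $T_1$ whose processes,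 besides message passing, may consult a single oracle $\mathcal O.T_2'$ where $T_2'$ is a renamed copy of $T_2$ whose consultant set contains or is contained in the process set of $T_1$; consultants that are not processes of $T_1$ never query and count as crashed from the start for the oracle (so here, processes $1,\dots,n$ may consult $\mathcal O.\mathrm{Cons}(n+1,f)$ on $\{1,\dots,n+1\}$, process $n+1$ being absent). *)

(* Defs.v *)
From mathcomp Require Import all_boot.
Set Implicit Arguments. Unset Strict Implicit. Unset Printing Implicit Defensive.

(* Processes of Pi = {1..n} are represented by 'I_n (process i+1 <-> i). *)

(* Binary consensus problem on k participants: Cons(F,W) = {v} if all entries
   of W equal v, {0,1} otherwise (it does not depend on F). *)
Definition ConsP (k : nat) (W : 'I_k -> bool) (d : bool) : Prop :=
  forall v : bool, (forall i, W i = v) -> d = v.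

(* Inputs of a local step: nothing, a message (sender, content), or the
   response d of the oracle to consultation c. *)
Inductive Inp (n : nat) (M : Type) : Type :=
| INone
| IRecv of 'I_n & M
| IResp of nat & bool.
Arguments INone {n M}.
Arguments IRecv {n M}.
Arguments IResp {n M}.

(* A deterministic algorithm for processes 'I_n.  A step of process p in local
   state s with input i yields the new state, the messages sent
   (destination, content), and possibly a query submitted to the oracle.
   adec s = Some d means that the process has decided d in state s. *)
Record Alg (n : nat) := {
  AS : Type;
  AM : Type;
  ainit : 'I_n -> bool -> AS;
  astep : 'I_n -> AS -> Inp n AM -> AS * seq ('I_n * AM) * option bool;
  adec : AS -> option bool }.
Arguments ainit {n} a.
Arguments astep {n} a.
Arguments adec {n} a.

(* Scheduled event kinds: a step with no input; a step receiving the i-th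
   message sent at time ts; a step receiving the oracle response of
   consultation c. *)
Inductive Ev : Type :=
| ENone
| EMsg of nat & nat
| EResp of nat.

(* A (candidate) history of the system: failure pattern, initial values,
   global states at each time, the event at each time (at most one process
   steps per time unit), the messages sent and query submitted at each time,
   and the oracle's common response to each consultation. *)
Record Run (n : nat) (A : Alg n) := {
  rF : nat -> {set 'I_n};
  rV : 'I_n -> bool;
  rst : nat -> 'I_n -> AS A;
  rev : nat -> option ('I_n * Ev);
  rsent : nat -> seq ('I_n * AM A);
  rqry : nat -> option bool;
  rresp : nat -> bool }.

Section Model.
Variables (n : nat) (A : Alg n) (R : Run A).

Definition correct (p : 'I_n) : Prop := forall t, p \notin rF R t.

Definition faulty_le (f : nat) : Prop :=
  exists X : {set 'I_n},
    (forall p, p \in X <-> exists t, p \in rF R t) /\ #|X| <= f.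

Definition is_query_step (p : 'I_n) (t : nat) : bool :=
  if rev R t is Some (q, _) then (q == p) && (rqry R t != None) else false.

Definition nqueries (p : 'I_n) (t : nat) : nat :=
  count (is_query_step p) (iota 0 t).

(* p submits query v at time t, in consultation c (the c-th query of p,
   counting from 0, belongs to consultation c). *)
Definition query_at (c : nat) (p : 'I_n) (v : bool) (t : nat) : Prop :=
  (exists e, rev R t = Some (p, e)) /\ rqry R t = Some v /\ nqueries p t = c.

Definition queried (c : nat) (p : 'I_n) : Prop :=
  exists v t, query_at c p v t.

Definition input_of (t : nat) (p : 'I_n) (e : Ev) (i : Inp n (AM A)) : Prop :=
  match e with
  | ENone => i = INone
  | EMsg ts k =>
      ts < t /\ exists (q : 'I_n) (m : AM A),
        (exists e', rev R ts = Some (q, e')) /\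
        onth (rsent R ts) k = Some (p, m) /\ i = IRecv q m
  | EResp c =>
      (exists v t', t' < t /\ query_at c p v t') /\ i = IResp c (rresp R c)
  end.

(* R is an admissible run of A with a (most general) oracle O.Cons(m, g)
   whose consultants are 'I_m; process p acts as consultant emb p, the
   consultants outside the image of emb never query. *)
Definition is_run (m g : nat) (emb : 'I_n -> 'I_m) : Prop :=
  (forall t, rF R t \subset rF R t.+1) /\
  (forall p, rst R 0 p = ainit A p (rV R p)) /\
  (forall t, match rev R t with
     | None => rst R t.+1 = rst R t /\ rsent R t = [::] /\ rqry R t = None
     | Some (p, e) =>
         p \notin rF R t /\
         exists i, input_of t p e i /\
           astep A p (rst R t p) i = (rst R t.+1 p, rsent R t, rqry R t) /\
           (forall q, q != p -> rst R t.+1 q = rst R t q)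
     end) /\
  (forall t1 t2 p1 p2 ts k,
      rev R t1 = Some (p1, EMsg ts k) -> rev R t2 = Some (p2, EMsg ts k) ->
      t1 = t2) /\
  (forall t1 t2 p c,
      rev R t1 = Some (p, EResp c) -> rev R t2 = Some (p, EResp c) -> t1 = t2) /\
  (forall t p c, rev R t = Some (p, EResp c) ->
     forall W : 'I_m -> bool,
       (forall q v t', t' < t -> query_at c q v t' -> W (emb q) = v) ->
       ConsP W (rresp R c)) /\
  (forall c, (exists Q : {set 'I_n}, m - g <= #|Q| /\ forall q, q \in Q -> queried c q) ->
     forall p, correct p -> queried c p ->
       exists t, rev R t = Some (p, EResp c)) /\
  (forall p, correct p -> forall t, exists t' e, t <= t' /\ rev R t' = Some (p, e)) /\
  (forall ts k p msg, onth (rsent R ts) k = Some (p, msg) -> correct p ->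
     exists t, rev R t = Some (p, EMsg ts k)).

Definition solves_in_run : Prop :=
  (forall p, correct p -> exists t d, adec A (rst R t p) = Some d) /\
  (forall p t d, adec A (rst R t p) = Some d ->
     forall t', t <= t' -> adec A (rst R t' p) = Some d) /\
  (forall p q t t' d d', adec A (rst R t p) = Some d ->
     adec A (rst R t' q) = Some d' -> d = d') /\
  (forall p t d, adec A (rst R t p) = Some d -> ConsP (rV R) d).

End Model.

Definition solves_with (n f m g : nat) (A : Alg n) (emb : 'I_n -> 'I_m) : Prop :=
  forall R : Run A, @is_run n A R m g emb -> faulty_le R f -> solves_in_run R.

(* Cons(n, f) <=_C Cons(m, g), for m >= n (consultant set contains the
   process set via the injective renaming emb). *)
Definition Cons_Creducible (n f m g : nat) : Prop :=
  exists (A : Alg n) (emb : 'I_n -> 'I_m), injective emb /\ solves_with f g A emb.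

(* Main.v *)
(* Let f - 1 processes take no step at all, and let the oracle answer a consultation only
   once all the n + 1 - f remaining processes L have queried it, with the conjunction of their
   queries. This is a legal behaviour of O.Cons(n+1, f), but such an oracle is no more than a
   message exchange that waits for everybody in L, and one process of L may still crash. The
   argument of Fischer, Lynch and Paterson then applies to L: some initial configuration is
   bivalent, any enabled event can be executed later so as to reach a bivalent configuration
   again, and a fair schedule through bivalent configurations yields an admissible run without
   decision. *)

Require Import Defs.
From mathcomp Require Import all_boot.
From Stdlib Require Import Classical ClassicalEpsilon FunctionalExtensionality.

Set Implicit Arguments.
Unset Strict Implicit.
Unset Printing Implicit Defensive.

(** * Configurations, events, and their commutation *)

Section Configurations.
Variables (n : nat) (A : Alg n) (L : {set 'I_n}).

(* [inl (q, j, k)] is the k-th message sent by q in its own j-th step, [inr c] the response to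
   consultation c. Naming messages by local step numbers rather than by global times makes
   steps of distinct processes commute. *)
Definition token := ('I_n * nat * nat + nat)%type.

Definition event := ('I_n * option token)%type.

(* [llog] lists, step by step, the messages sent and the query submitted; [lgot] the tokens
   already received. *)
Record local := Local {
  lst : AS A;
  llog : seq (seq ('I_n * AM A) * option bool);
  lgot : seq token }.

Definition lqs (l : local) : seq bool := pmap snd (llog l).

Definition conf := 'I_n -> local.

Definition init (V : 'I_n -> bool) : conf := fun p => Local (ainit A p (V p)) [::] [::].

Definition full (C : conf) (c : nat) : bool := [forall q in L, c < size (lqs (C q))].

(** If all of a nonempty [L] submit the same value, this conjunction equals it, which is what
    [ConsP] demands. The default [true] is neutral and is never read once [full C c] holds. *)
Definition resp (C : conf) (c : nat) : bool := [forall q in L, nth true (lqs (C q)) c].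

Definition inp (C : conf) (a : event) : option (Inp n (AM A)) :=
  match a.2 with
  | None => Some INone
  | Some (inl (q, j, k)) =>
      if onth (nth ([::], None) (llog (C q)) j).1 k is Some (p, m)
      then if p == a.1 then Some (IRecv q m) else None else None
  | Some (inr c) => if full C c then Some (IResp c (resp C c)) else None
  end.

Definition fresh (l : local) (e : option token) : bool :=
  if e is Some x then x \notin lgot l else true.

Definition enabled (C : conf) (a : event) : bool :=
  fresh (C a.1) a.2 && isSome (inp C a).

Definition lstep (p : 'I_n) (e : option token) (l : local) (i : Inp n (AM A)) : local :=
  let r := astep A p (lst l) i in
  Local r.1.1 (rcons (llog l) (r.1.2, r.2)) (seq_of_opt e ++ lgot l).

Definition exec (C : conf) (a : event) : conf := fun q =>
  if inp C a is Some i then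
    if q == a.1 then lstep a.1 a.2 (C a.1) i else C q
  else C q.

(** Only logs are compared because [inp] reads nothing else; available inputs therefore persist
    along this order ([inp_le]). *)
Definition le_conf (C C' : conf) : Prop :=
  forall q, exists r, llog (C' q) = llog (C q) ++ r.

Lemma le_conf_refl C : le_conf C C.
Proof. by move=> q; exists [::]; rewrite cats0. Qed.

Lemma le_conf_trans C2 C1 C3 : le_conf C1 C2 -> le_conf C2 C3 -> le_conf C1 C3.
Proof.
move=> h12 h23 q; have [r1 e1] := h12 q; have [r2 e2] := h23 q.
by exists (r1 ++ r2); rewrite e2 e1 catA.
Qed.

Lemma exec_other C a q : q != a.1 -> exec C a q = C q.
Proof. by move=> /negbTE h; rewrite /exec; case: (inp C a) => // i; rewrite h. Qed.

Lemma exec_self C a i : inp C a = Some i -> exec C a a.1 = lstep a.1 a.2 (C a.1) i.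
Proof. by move=> h; rewrite /exec h eqxx. Qed.

Lemma le_exec C a : le_conf C (exec C a).
Proof.
move=> q; rewrite /exec; case: (inp C a) => [i|]; last by exists [::]; rewrite cats0.
case: eqP => [->|_]; last by exists [::]; rewrite cats0.
by eexists; rewrite /= -cats1.
Qed.

Lemma lqs_le C C' q : le_conf C C' -> exists r, lqs (C' q) = lqs (C q) ++ r.
Proof. by move=> /(_ q) [r e]; rewrite /lqs e pmap_cat; eexists. Qed.

Lemma full_le C C' c : le_conf C C' -> full C c -> full C' c.
Proof.
move=> le /forall_inP h; apply/forall_inP => q qL.
have [r ->] := lqs_le q le; rewrite size_cat.
exact: leq_trans (h q qL) (leq_addr _ _).
Qed.

Lemma resp_le C C' c : le_conf C C' -> full C c -> resp C' c = resp C c.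
Proof.
move=> le /forall_inP h; rewrite /resp; apply: eq_forallb => q.
case qL: (q \in L) => //=; have [r ->] := lqs_le q le.
by rewrite nth_cat (h q qL).
Qed.

Lemma inp_le C C' a i : le_conf C C' -> inp C a = Some i -> inp C' a = Some i.
Proof.
move=> le; rewrite /inp; case: a.2 => [[[[q j] k]|c]|] //.
  have [r ->] := le q; rewrite nth_cat; case: ltnP => // h.
  by rewrite (nth_default ([::], None) h) /= onth0n.
by case: ifP => // fu; rewrite (full_le le fu) (resp_le le fu).
Qed.

Lemma enabled_le C C' a : le_conf C C' -> lgot (C' a.1) = lgot (C a.1) ->
  enabled C a -> enabled C' a.
Proof.
rewrite /enabled /fresh => le -> /andP[-> /=].
by case e: (inp C a) => [i|] // _; rewrite (inp_le le e).
Qed.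

(** Logs only grow, so an available input stays available; [a] can be disabled only by the receipt
    of its own token, that is, by [a] itself. *)
Lemma enabled_exec C a b : enabled C a -> b != a -> enabled (exec C b) a.
Proof.
move=> ea ba; have [eab|ab] := eqVneq a.1 b.1; last first.
  by apply: enabled_le ea; [exact: le_exec | rewrite exec_other].
case/andP: ea => fr; rewrite /enabled.
case e: (inp C a) => [i|] // _; rewrite (inp_le (@le_exec C b) e) andbT.
rewrite /exec; case: (inp C b) => [i'|] //; rewrite eab eqxx.
move: fr ba; rewrite /fresh; case: b eab => p eb /= eab; case: a eab {e} => p' ea /= <-.
case: ea => // x xn; rewrite xpair_eqE eqxx /= => ne.
rewrite mem_cat negb_or xn andbT; case: eb ne => //= y; apply: contraNN.
by rewrite inE => /eqP ->.
Qed.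

Lemma enabled_skip C p : enabled C (p, None).
Proof. by []. Qed.

(** Each step writes only the component of its own process, and its input is unaffected by the
    growth of the other log. *)
Lemma exec_comm C a b : enabled C a -> enabled C b -> a.1 != b.1 ->
  exec (exec C a) b = exec (exec C b) a.
Proof.
case/andP=> _; case ea: (inp C a) => [i|] // _.
case/andP=> _; case eb: (inp C b) => [j|] // _ ab.
apply: functional_extensionality => q.
have ea' := inp_le (@le_exec C b) ea; have eb' := inp_le (@le_exec C a) eb.
have [->|qa] := eqVneq q a.1.
  by rewrite exec_other // (exec_self ea) (exec_self ea') exec_other.
rewrite [RHS]exec_other //; have [->|qb] := eqVneq q b.1.
  by rewrite (exec_self eb) (exec_self eb') exec_other // eq_sym.
by rewrite !exec_other.
Qed.

(** * Finite schedules, and configurations that differ at one process *)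

Fixpoint valid (Y : {set 'I_n}) (C : conf) (s : seq event) : bool :=
  if s is a :: s' then [&& a.1 \in Y, enabled C a & valid Y (exec C a) s'] else true.

Lemma valid_cat Y C s1 s2 :
  valid Y C (s1 ++ s2) = valid Y C s1 && valid Y (foldl exec C s1) s2.
Proof. by elim: s1 C => //= a s IH C; rewrite IH !andbA. Qed.

Lemma valid_rcons Y C s a :
  valid Y C (rcons s a) = [&& valid Y C s, a.1 \in Y & enabled (foldl exec C s) a].
Proof. by rewrite -cats1 valid_cat /= andbT. Qed.

Lemma valid_sub (Y Y' : {set 'I_n}) C s : Y \subset Y' -> valid Y C s -> valid Y' C s.
Proof.
by move=> /subsetP sub; elim: s C => //= a s IH C /and3P[/sub -> -> /IH].
Qed.

Lemma enabled_foldl C a s : enabled C a -> a \notin s -> enabled (foldl exec C s) a.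
Proof.
elim: s C => //= b s IH C en; rewrite inE negb_or => /andP[ab nin].
by apply: IH => //; apply: enabled_exec; rewrite // eq_sym.
Qed.

(* [C'] may differ from [C] at [p] only, and has there at least the messages and queries of
   [C]: the other processes cannot tell the two apart as long as [p] is silent. *)
Definition sim (p : 'I_n) (C C' : conf) : Prop :=
  (forall q, q != p -> C q = C' q) /\ le_conf C C'.

Lemma sim_exec p C C' a : sim p C C' -> a.1 != p -> enabled C a ->
  enabled C' a /\ sim p (exec C a) (exec C' a).
Proof.
move=> [eqC le] ap en; have en' : enabled C' a by apply: enabled_le en; rewrite ?eqC.
split=> //; case/andP: en => _; case e: (inp C a) => [i|] // _.
have e' := inp_le le e.
have eqE q : q != p -> exec C a q = exec C' a q.
  by move=> qp; rewrite /exec e e' !eqC.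
split=> // q; have [->|qp] := eqVneq q p.
  by rewrite !exec_other 1?eq_sym.
by rewrite eqE //; exists [::]; rewrite cats0.
Qed.

Lemma sim_valid p Y C C' s : sim p C C' -> valid (Y :\ p) C s ->
  valid (Y :\ p) C' s /\ sim p (foldl exec C s) (foldl exec C' s).
Proof.
elim: s C C' => [|a s IH] C C' //= si /and3P[aY en va].
have ap : a.1 != p by move: aY; rewrite in_setD1 => /andP[].
have [en' si'] := sim_exec si ap en.
by have [-> si''] := IH _ _ si' va; rewrite aY en'.
Qed.

Lemma sim_exec_self C a : sim a.1 C (exec C a).
Proof. by split=> [q qa|]; [rewrite exec_other | exact: le_exec]. Qed.

Lemma sim_trans p C1 C2 C3 : sim p C1 C2 -> sim p C2 C3 -> sim p C1 C3.
Proof.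
move=> [e1 l1] [e2 l2]; split=> [q qp|]; first by rewrite e1 ?e2.
exact: le_conf_trans l1 l2.
Qed.

Definition decided (C : conf) (v : bool) : Prop :=
  exists p, adec A (lst (C p)) = Some v.

End Configurations.

(** * From an infinite fair schedule to an admissible run *)

Section ScheduledRun.
Variables (n f : nat) (A : Alg n) (L Y : {set 'I_n}) (V : 'I_n -> bool).
Variables (sigma : nat -> event n) (T : nat).

Definition conf_at (t : nat) : conf A := foldl (exec L) (init A V) (mkseq sigma t).

Hypothesis card_L : #|L| = n.+1 - f.
Hypothesis f_le : f <= n.
Hypothesis enabled_sigma : forall t, enabled L (conf_at t) (sigma t).
Hypothesis sigma_L : forall t, (sigma t).1 \in L.
Hypothesis sigma_Y : forall t, T <= t -> (sigma t).1 \in Y.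
Hypothesis fair_sigma : forall a t, a.1 \in Y -> enabled L (conf_at t) a ->
  exists2 t', t <= t' & sigma t' = a.

Lemma conf_atS t : conf_at t.+1 = exec L (conf_at t) (sigma t).
Proof. by rewrite /conf_at mkseqS foldl_rcons. Qed.

Lemma le_conf_at t1 t2 : t1 <= t2 -> le_conf (conf_at t1) (conf_at t2).
Proof.
move=> /subnK <-; elim: (t2 - t1) => [|d IH]; first exact: le_conf_refl.
by rewrite addSn conf_atS; apply: le_conf_trans IH (@le_exec _ _ _ _ _).
Qed.

Definition entry_at (t : nat) : seq ('I_n * AM A) * option bool :=
  last ([::], None) (llog (conf_at t.+1 (sigma t).1)).

Lemma sigma_step t : exists i, [/\ inp L (conf_at t) (sigma t) = Some i,
  astep A (sigma t).1 (lst (conf_at t (sigma t).1)) i =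
    (lst (conf_at t.+1 (sigma t).1), (entry_at t).1, (entry_at t).2)
  & conf_at t.+1 (sigma t).1 =
     lstep (sigma t).1 (sigma t).2 (conf_at t (sigma t).1) i].
Proof.
case/andP: (enabled_sigma t) => _; case e: inp => [i|] // _; exists i.
have eS : conf_at t.+1 (sigma t).1 =
    lstep (sigma t).1 (sigma t).2 (conf_at t (sigma t).1) i.
  by rewrite conf_atS (exec_self e).
split=> //; rewrite /entry_at eS /= last_rcons /=.
by case: (astep _ _ _ _) => [[]].
Qed.

Lemma llogS t p : llog (conf_at t.+1 p) =
  if p == (sigma t).1 then rcons (llog (conf_at t p)) (entry_at t)
  else llog (conf_at t p).
Proof.
case: eqP => [->|/eqP ne]; last by rewrite conf_atS exec_other.
have [i [_ _ e]] := sigma_step t.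
by rewrite /entry_at e /= last_rcons.
Qed.

Lemma lgotS t p : lgot (conf_at t.+1 p) =
  (if p == (sigma t).1 then seq_of_opt (sigma t).2 else [::]) ++ lgot (conf_at t p).
Proof.
case: eqP => [->|/eqP ne]; last by rewrite conf_atS exec_other.
by have [i [_ _ ->]] := sigma_step t.
Qed.

Lemma lqsS t p : lqs (conf_at t.+1 p) =
  if p == (sigma t).1 then lqs (conf_at t p) ++ seq_of_opt (entry_at t).2
  else lqs (conf_at t p).
Proof.
rewrite /lqs llogS; case: eqP => // _.
by rewrite -cats1 pmap_cat /=; case: (entry_at t).2.
Qed.

Lemma mem_lgot t p x : x \in lgot (conf_at t p) ->
  exists2 s, s < t & sigma s = (p, Some x).
Proof.
elim: t => [|t IH] //; rewrite lgotS mem_cat => /orP[|/IH [s st e]]; last first.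
  by exists s => //; apply: ltnW.
case: eqP => // ->; case e: (sigma t) => [q [y|]] //=.
by rewrite inE => /eqP ->; exists t.
Qed.

Lemma lgot_mem s t p x : s < t -> sigma s = (p, Some x) -> x \in lgot (conf_at t p).
Proof.
move=> st e; elim: t st => // t IH; rewrite ltnS leq_eqVlt lgotS mem_cat.
by move=> /predU1P[<-|/IH ->]; rewrite ?orbT // e eqxx /= inE eqxx.
Qed.

(** A received token enters [lgot] and is never fresh again. This gives the clauses of [is_run] that
    forbid duplicate deliveries. *)
Lemma sigma_inj s t p x : sigma s = (p, Some x) -> sigma t = (p, Some x) -> s = t.
Proof.
wlog lt : s t / s < t.
  move=> H es et; case: (ltngtP s t) => // h; first exact: H.
  by symmetry; apply: H.
move=> es et; have /andP[] := enabled_sigma t.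
by rewrite et /= (lgot_mem lt es).
Qed.

(** Links the local step numbers used in tokens to the global times that [EMsg] refers to. *)
Definition log_time (q : 'I_n) (j s : nat) : Prop :=
  (sigma s).1 = q /\ size (llog (conf_at s q)) = j.

Lemma log_timeP t q j : j < size (llog (conf_at t q)) ->
  exists2 s, s < t & log_time q j s.
Proof.
elim: t => [|t IH] //; rewrite llogS; case: eqP => [eq|_]; last first.
  by case/IH=> s st h; exists s => //; apply: ltnW.
rewrite size_rcons ltnS leq_eqVlt => /predU1P[->|/IH [s st h]].
  by exists t.
by exists s => //; apply: ltnW.
Qed.

Lemma nth_llog t s q j : s < t -> log_time q j s ->
  nth ([::], None) (llog (conf_at t q)) j = entry_at s.
Proof.
move=> /le_conf_at /(_ q) [r ->] [eq <-].
by rewrite llogS eq eqxx nth_cat size_rcons leqnn nth_rcons ltnn eqxx.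
Qed.

Lemma log_time_inj q j s s' : log_time q j s -> log_time q j s' -> s = s'.
Proof.
wlog lt : s s' / s < s'.
  move=> H es et; case: (ltngtP s s') => // h; first exact: H.
  by symmetry; apply: H.
move=> [e1 e2] [e3 e4]; have [r] := le_conf_at lt q.
rewrite llogS e1 eqxx => /(congr1 size).
rewrite size_cat size_rcons e2 e4 => /eqP.
by rewrite addSn -addnS -[X in X == _]addn0 eqn_add2l.
Qed.

Definition send_time (q : 'I_n) (j : nat) : nat :=
  epsilon (inhabits 0) (log_time q j).

Lemma send_timeE q j s : log_time q j s -> send_time q j = s.
Proof.
move=> h; apply: (log_time_inj _ h); rewrite /send_time.
by apply: epsilon_spec; exists s.
Qed.

Definition ev_at (t : nat) : Ev :=
  match (sigma t).2 with
  | None => ENone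
  | Some (inl (q, j, k)) => EMsg (send_time q j) k
  | Some (inr c) => EResp c
  end.

(** By [resp_le] every time at which [c] is full gives the same response. If [c] never becomes full,
    the value is arbitrary and never delivered. *)
Definition resp_at (c : nat) : bool :=
  resp L (conf_at (epsilon (inhabits 0) (fun t => full L (conf_at t) c))) c.

Lemma resp_atE t c : full L (conf_at t) c -> resp_at c = resp L (conf_at t) c.
Proof.
move=> fu; rewrite /resp_at; set t0 := epsilon _ _.
have fu0 : full L (conf_at t0) c.
  by apply: (epsilon_spec (inhabits 0) (fun t => full L (conf_at t) c)); exists t.
case: (leqP t t0) => h; first exact: resp_le (le_conf_at h) fu.
by symmetry; apply: resp_le (le_conf_at (ltnW h)) fu0.
Qed.

Definition scheduled_run : Run A := {|
  rF := fun t => if t < T then set0 else ~: Y;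
  rV := V;
  rst := fun t p => lst (conf_at t p);
  Defs.rev := fun t => Some ((sigma t).1, ev_at t);
  rsent := fun t => (entry_at t).1;
  rqry := fun t => (entry_at t).2;
  rresp := resp_at |}.

Local Notation R := scheduled_run.

Lemma correctE p : correct R p <-> p \in Y.
Proof.
rewrite /correct /=; split=> [/(_ T)|pY t]; first by rewrite ltnn inE negbK.
by case: ifP => _; rewrite ?inE // negbK.
Qed.

Lemma nqueriesE p t : nqueries R p t = size (lqs (conf_at t p)).
Proof.
elim: t => [|t IH] //; rewrite /nqueries -[t.+1]addn1 iotaD count_cat.
rewrite -/(nqueries R p t) IH add0n addn1 lqsS /is_query_step /= eq_sym addn0.
case: eqP => _ /=; last by rewrite addn0.
by rewrite size_cat; case: (entry_at t).2.
Qed.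

Lemma query_atE c p v t : query_at R c p v t <->
  [/\ (sigma t).1 = p, (entry_at t).2 = Some v & size (lqs (conf_at t p)) = c].
Proof.
rewrite /query_at nqueriesE /=; split=> [[[e [<- _]] [-> <-]]|[<- -> <-]] //.
by split; [exists (ev_at t) | split].
Qed.

Lemma query_lqs c p v s t : s < t -> query_at R c p v s ->
  c < size (lqs (conf_at t p)) /\ nth true (lqs (conf_at t p)) c = v.
Proof.
move=> st /query_atE[ep ev ec]; have [r ->] := lqs_le p (le_conf_at st).
rewrite lqsS ep eqxx ev /= size_cat size_cat ec /= addn1 addSn ltnS leq_addr.
by rewrite nth_cat size_cat ec addn1 leqnn nth_cat ec ltnn subnn.
Qed.

Lemma lqs_query c p t : c < size (lqs (conf_at t p)) ->
  exists v s, s < t /\ query_at R c p v s.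
Proof.
elim: t => [|t IH] //; rewrite lqsS.
have old : c < size (lqs (conf_at t p)) -> exists v s, s < t.+1 /\ query_at R c p v s.
  by case/IH=> v [s [st h]]; exists v, s; split=> //; apply: ltnW.
case: eqP => // ep; case ev: (entry_at t).2 => [v|] /=; last by rewrite cats0.
rewrite size_cat addn1 ltnS leq_eqVlt => /predU1P[ec|//].
by exists v, t; split=> //; apply/query_atE; split.
Qed.

Lemma full_queried c t : full L (conf_at t) c ->
  forall q, q \in L -> exists v s, s < t /\ query_at R c q v s.
Proof. by move=> /forall_inP fu q /fu /lqs_query. Qed.

Lemma sigma_msg t p ts k : (sigma t).1 = p -> ev_at t = EMsg ts k ->
  exists q j m, [/\ sigma t = (p, Some (inl (q, j, k))), log_time q j ts, ts < t,
    onth (entry_at ts).1 k = Some (p, m) & inp L (conf_at t) (sigma t) = Some (IRecv q m)].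
Proof.
rewrite /ev_at; case e: (sigma t) => [p' [[[[q j] k']|c]|]] //= ep [ets ek].
subst k' p'.
have [i [ei _ _]] := sigma_step t; move: (ei); rewrite /inp e /=.
case: (ltnP j (size (llog (conf_at t q)))) => [|ge]; last first.
  by rewrite (nth_default _ ge) onth0n.
case/log_timeP => s st hs; rewrite (nth_llog st hs).
case eo: (onth _ _) => [[p' m]|] //; case: eqP => // ep _; subst p'.
rewrite (send_timeE hs) in ets; subst s; by exists q, j, m.
Qed.

Lemma sigma_resp t p c : (sigma t).1 = p -> ev_at t = EResp c ->
  [/\ sigma t = (p, Some (inr c)), full L (conf_at t) c
    & inp L (conf_at t) (sigma t) = Some (IResp c (resp_at c))].
Proof.
rewrite /ev_at; case e: (sigma t) => [p' [[[[q j] k]|c']|]] //= ep [ec].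
subst c' p'; have [i [ei _ _]] := sigma_step t; move: (ei); rewrite /inp e /=.
by case: ifP => // fu _; rewrite (resp_atE fu).
Qed.

Lemma mem_L_nonempty : exists p, p \in L.
Proof.
have : 0 < #|L| by rewrite card_L subn_gt0 ltnS.
by case/card_gt0P=> p pL; exists p.
Qed.

Lemma queried_L c p : queried R c p -> p \in L.
Proof. by case=> v [t /query_atE[<- _ _]]; apply: sigma_L. Qed.

Lemma full_eventually c : (forall q, q \in L -> queried R c q) ->
  exists t, full L (conf_at t) c.
Proof.
move=> H; have /all_sig [g gP] : forall q, {t | q \in L -> c < size (lqs (conf_at t q))}.
  move=> q; apply: constructive_indefinite_description.
  case qL: (q \in L); last by exists 0.
  have [v [s h]] := H q qL; exists s.+1 => _.
  by have [] := query_lqs (ltnSn s) h.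
exists (\max_(q in L) g q); apply/forall_inP => q qL.
have gq : g q <= \max_(q in L) g q by apply: leq_bigmax_cond.
have [r ->] := lqs_le q (le_conf_at gq).
by rewrite size_cat; apply: leq_trans (gP q qL) (leq_addr _ _).
Qed.

Lemma eventually_executed p x t : p \in Y -> isSome (inp L (conf_at t) (p, Some x)) ->
  exists t', sigma t' = (p, Some x).
Proof.
move=> pY hi; case got: (x \in lgot (conf_at t p)).
  by have [s _ e] := mem_lgot got; exists s.
have en : enabled L (conf_at t) (p, Some x) by rewrite /enabled /= got hi.
by have [t' _ e] := fair_sigma (a := (p, Some x)) pY en; exists t'.
Qed.

Lemma scheduled_is_run (emb : 'I_n -> 'I_n.+1) : is_run R f emb.
Proof.
split; [|split; [|split; [|split; [|split; [|split; [|split; [|split]]]]]]].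
- move=> t /=; case: ifP => [_|h]; first exact: sub0set.
  by case: ifP => // h'; rewrite (ltnW h') in h.
- by [].
- move=> t /=; split.
    by case: ltnP => h; rewrite inE // negbK sigma_Y.
  have [i [ei ea _]] := sigma_step t; exists i; split; last first.
    by split=> [|q ne]; [rewrite ea | rewrite conf_atS exec_other].
  case ev: (ev_at t) => [|ts k|c] /=.
  + by move: ev ei; rewrite /ev_at /inp; case: (sigma t).2 => [[[[]]|]|] // _ [].
  + have [q [j [m [_ [eq _] lt eo eI]]]] := sigma_msg (erefl _) ev.
    split=> //; exists q, m; split; first by exists (ev_at ts); rewrite eq.
    by split=> //; move: ei; rewrite eI => -[].
  + have [_ fu eI] := sigma_resp (erefl _) ev.
    split; last by move: ei; rewrite eI => -[].
    by have [v [s [h1 h2]]] := full_queried fu (sigma_L t); exists v, s.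
- move=> t1 t2 p1 p2 ts k [e1 v1] [e2 v2].
  have [q1 [j1 [m1 [s1 [q1E j1E] _ o1 _]]]] := sigma_msg e1 v1.
  have [q2 [j2 [m2 [s2 [q2E j2E] _ o2 _]]]] := sigma_msg e2 v2.
  move: o2; rewrite o1 => -[ep _]; subst q1 q2 j1 j2.
  by rewrite -ep in s2; apply: sigma_inj s1 s2.
- move=> t1 t2 p c [e1 v1] [e2 v2].
  have [s1 _ _] := sigma_resp e1 v1; have [s2 _ _] := sigma_resp e2 v2.
  exact: sigma_inj s1 s2.
- move=> t p c [e1 v1] W hW v Wv; have [_ fu _] := sigma_resp e1 v1.
  (* All of [L] queried before the delivery, so a constant [W] extending these queries forces each
     of them to be [v]. *)
  have nthE q : q \in L -> nth true (lqs (conf_at t q)) c = v.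
    move=> /(full_queried fu) [w [s [st h]]]; have [_ ->] := query_lqs st h.
    by rewrite -(hW _ _ _ st h) Wv.
  rewrite /= (resp_atE fu) /resp; case: v {Wv} nthE => nthE.
    by apply/forall_inP => q /nthE.
  apply/negP => /forall_inP h; have [q qL] := mem_L_nonempty.
  by move: (h q qL); rewrite nthE.
- move=> c [Q [cQ hQ]] p /correctE pY _.
  (* Only processes of [L] query, and [L] has exactly [n.+1 - f] elements. So whenever the oracle is
     obliged to answer, all of [L] has queried and the restricted oracle answers too. *)
  have QL : Q \subset L by apply/subsetP => q /hQ /queried_L.
  have eQ : Q = L by apply/eqP; rewrite eqEcard QL card_L.
  rewrite eQ in hQ; have [t fu] := full_eventually hQ.
  have [|t' et'] := @eventually_executed p (inr c) t pY; first by rewrite /inp /= fu.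
  by exists t'; rewrite /= /ev_at et'.
- move=> p /correctE pY t.
  have [t' tt' e] := @fair_sigma (p, None) t pY (enabled_skip _ _ _).
  by exists t', (ev_at t'); rewrite /= e.
- move=> ts k p msg /= eo /correctE pY.
  set q := (sigma ts).1; set j := size (llog (conf_at ts q)).
  have lt : log_time q j ts by [].
  have [|t et] := @eventually_executed p (inl (q, j, k)) ts.+1 pY.
    by rewrite /inp /= (nth_llog (ltnSn ts) lt) eo eqxx.
  by exists t; rewrite /ev_at et /= (send_timeE lt).
Qed.

End ScheduledRun.

(** * Fair infinite schedules along an invariant *)

Section FairSchedule.
Variables (n : nat) (A : Alg n) (L Y : {set 'I_n}) (C0 : conf A).
Variable Inv : seq (event n) -> Prop.

Hypothesis Inv_extend : forall s a, Inv s -> a.1 \in Y ->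
  enabled L (foldl (exec L) C0 s) a ->
  exists s', [/\ valid L Y (foldl (exec L) C0 s) s', a \in s' & Inv (s ++ s')].

Variables (p0 : 'I_n) (s0 : seq (event n)).
Hypotheses (p0Y : p0 \in Y) (Inv_s0 : Inv s0).

(* Every event is the target of infinitely many rounds, since [logn 2 (2 ^ c * 3 ^ k) = c]. *)
Definition target (m : nat) (s : seq (event n)) : event n :=
  if unpickle (logn 2 m) is Some a then
    if (a.1 \in Y) && enabled L (foldl (exec L) C0 s) a then a else (p0, None)
  else (p0, None).

Lemma target_ok m s : ((target m s).1 \in Y) /\ enabled L (foldl (exec L) C0 s) (target m s).
Proof.
by rewrite /target; case: (unpickle _) => [a|] //; case: ifP => // /andP[].
Qed.

Definition round_spec (m : nat) (s s' : seq (event n)) : Prop :=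
  [/\ valid L Y (foldl (exec L) C0 s) s', target m s \in s' & Inv (s ++ s')].

Definition round (m : nat) (s : seq (event n)) : seq (event n) :=
  epsilon (inhabits [::]) (round_spec m s).

Fixpoint rounds (m : nat) : seq (event n) :=
  if m is m'.+1 then rounds m' ++ round m' (rounds m') else s0.

Lemma rounds_Inv m : Inv (rounds m).
Proof.
elim: m => //= m IH; have [tY te] := target_ok m (rounds m).
by have [] := epsilon_spec (inhabits [::]) (round_spec m (rounds m)) (Inv_extend IH tY te).
Qed.

Lemma roundP m : round_spec m (rounds m) (round m (rounds m)).
Proof.
have [tY te] := target_ok m (rounds m).
exact: epsilon_spec (inhabits [::]) (round_spec m (rounds m)) (Inv_extend (rounds_Inv m) tY te).
Qed.

Lemma size_round m : 0 < size (round m (rounds m)).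
Proof. by have [_ h _] := roundP m; case: (round _ _) h. Qed.

Lemma size_rounds m : size s0 + m <= size (rounds m).
Proof.
elim: m => [|m IH]; first by rewrite addn0.
by rewrite /= size_cat addnS -addn1; apply: leq_add (size_round m).
Qed.

Lemma rounds_prefix m m' : m <= m' -> exists r, rounds m' = rounds m ++ r.
Proof.
move=> /subnK <-; elim: (m' - m) => [|d [r IH]]; first by exists [::]; rewrite cats0.
by rewrite addSn /= [in X in X ++ _]IH -catA; eexists.
Qed.

(** Rounds are nonempty, so [rounds t.+1] has more than [t] events, and later rounds do not change
    position [t]. *)
Definition fair_sched (t : nat) : event n := nth (p0, None) (rounds t.+1) t.

Lemma fair_schedE t m : t < size (rounds m) -> fair_sched t = nth (p0, None) (rounds m) t.
Proof.
move=> tm; rewrite /fair_sched; have ts : t < size (rounds t.+1).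
  exact: leq_trans (leq_addl _ _) (size_rounds _).
case: (leqP m t.+1) => [|/ltnW] /rounds_prefix [r ->].
  by rewrite nth_cat tm.
by rewrite [RHS]nth_cat ts.
Qed.

Lemma mkseq_fair_sched t m : t <= size (rounds m) ->
  mkseq fair_sched t = take t (rounds m).
Proof.
move=> tm; apply: (@eq_from_nth _ (p0, None)); rewrite size_mkseq.
  by rewrite size_takel.
by move=> i it; rewrite nth_mkseq // nth_take // (@fair_schedE i m) // (leq_trans it).
Qed.

Lemma mkseq_rounds m : mkseq fair_sched (size (rounds m)) = rounds m.
Proof. by rewrite (@mkseq_fair_sched _ m) // take_size. Qed.

Lemma valid_nth Y' (C : conf A) s t : valid L Y' C s -> t < size s ->
  (nth (p0, None) s t).1 \in Y' /\
  enabled L (foldl (exec L) C (take t s)) (nth (p0, None) s t).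
Proof.
move=> va ts; move: va; rewrite -(cat_take_drop t s) valid_cat (drop_nth (p0, None) ts) /=.
case/and4P=> _ aY en _; rewrite nth_cat size_takel ?(ltnW ts) // ltnn subnn /=.
by rewrite take_cat size_takel ?(ltnW ts) // ltnn subnn take0 cats0.
Qed.

Lemma rounds_suffix m : exists r, rounds m = s0 ++ r /\ valid L Y (foldl (exec L) C0 s0) r.
Proof.
elim: m => [|m [r [e va]]]; first by exists [::]; rewrite cats0.
have [va' _ _] := roundP m; exists (r ++ round m (rounds m)).
by rewrite /= [in LHS]e catA valid_cat va -foldl_cat -e.
Qed.

Lemma fair_sched_Y t : size s0 <= t -> (fair_sched t).1 \in Y /\
  enabled L (foldl (exec L) C0 (mkseq fair_sched t)) (fair_sched t).
Proof.
move=> t0; have ts : t < size (rounds t.+1).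
  exact: leq_trans (leq_addl _ _) (size_rounds _).
rewrite (fair_schedE ts) (mkseq_fair_sched (ltnW ts)).
have [r [e va]] := rounds_suffix t.+1; rewrite e in ts *.
rewrite nth_cat take_cat ltnNge t0 /= foldl_cat.
by apply: valid_nth va _; rewrite -(ltn_add2l (size s0)) subnKC // -size_cat.
Qed.

Lemma fair_sched_prefix Y' t : valid L Y' C0 s0 -> t < size s0 -> (fair_sched t).1 \in Y' /\
  enabled L (foldl (exec L) C0 (mkseq fair_sched t)) (fair_sched t).
Proof.
move=> va t0; rewrite (@fair_schedE t 0) // (@mkseq_fair_sched t 0) ?(ltnW t0) //.
exact: valid_nth.
Qed.

Lemma fair_sched_fair a t : a.1 \in Y ->
  enabled L (foldl (exec L) C0 (mkseq fair_sched t)) a ->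
  exists2 t', t <= t' & fair_sched t' = a.
Proof.
(* The factor [2 ^ pickle a] makes [a] the target of round [m] if it is enabled then; the factor
   [3 ^ t] makes this round start no earlier than time [t]. *)
move=> aY en; set m := 2 ^ pickle a * 3 ^ t.
have lm : logn 2 m = pickle a by rewrite /m lognM ?expn_gt0 // !lognX /= muln0 addn0 muln1.
have tm : t <= size (rounds m).
  apply: leq_trans (leq_trans (leq_addl (size s0) _) (size_rounds m)).
  apply: leq_trans (ltnW (ltn_expl t (isT : 1 < 3))) _.
  by rewrite /m leq_pmull // expn_gt0.
have [r er] : exists r, rounds m = mkseq fair_sched t ++ r.
  by exists (drop t (rounds m)); rewrite (mkseq_fair_sched tm) cat_take_drop.
have [i [ti im ei]] : exists i, [/\ t <= i, i < size (rounds m.+1)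
    & nth (p0, None) (rounds m.+1) i = a].
  have szr : size (rounds m) = t + size r by rewrite er size_cat size_mkseq.
  (* Either [a] occurs between time [t] and the start of round [m], or it is still enabled at that
     start and the round executes it. *)
  case ar: (a \in r).
    exists (t + index a r); rewrite leq_addr /= size_cat szr; split=> //.
      by rewrite -addnA ltn_add2l ltn_addr // index_mem.
    rewrite nth_cat szr ltn_add2l index_mem ar er nth_cat size_mkseq ltnNge leq_addr /=.
    by rewrite addKn nth_index.
  have en' : enabled L (foldl (exec L) C0 (rounds m)) a.
    by rewrite er foldl_cat; apply: enabled_foldl; rewrite ?ar.
  have [_ + _] := roundP m; rewrite /target lm pickleK aY en' /= => ain.
  exists (size (rounds m) + index a (round m (rounds m))); split.
  - by rewrite szr -addnA leq_addr.
  - by rewrite /= size_cat ltn_add2l index_mem.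
  - by rewrite /= nth_cat ltnNge leq_addr /= addKn nth_index.
by exists i; rewrite // (fair_schedE im).
Qed.

End FairSchedule.

(** Applied with a trivial invariant to continue a finite schedule fairly, and with bivalence to
    build the run without decision. *)
Lemma fair_schedule_exists (n : nat) (A : Alg n) (L Y : {set 'I_n}) (C0 : conf A)
    (Inv : seq (event n) -> Prop) (p0 : 'I_n) (s0 : seq (event n)) :
  (forall s a, Inv s -> a.1 \in Y -> enabled L (foldl (exec L) C0 s) a ->
     exists s', [/\ valid L Y (foldl (exec L) C0 s) s', a \in s' & Inv (s ++ s')]) ->
  Y \subset L -> p0 \in Y -> valid L L C0 s0 -> Inv s0 ->
  exists sigma : nat -> event n,
    [/\ mkseq sigma (size s0) = s0,
        forall t, (sigma t).1 \in L /\ enabled L (foldl (exec L) C0 (mkseq sigma t)) (sigma t),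
        forall t, size s0 <= t -> (sigma t).1 \in Y,
        forall a t, a.1 \in Y -> enabled L (foldl (exec L) C0 (mkseq sigma t)) a ->
          exists2 t', t <= t' & sigma t' = a
      & forall t, exists2 t', t <= t' & Inv (mkseq sigma t')].
Proof.
move=> ext /subsetP YL p0Y va I0; exists (fair_sched L Y C0 Inv p0 s0); split.
- exact: (mkseq_rounds ext p0Y I0 0).
- move=> t; case: (ltnP t (size s0)) => ts; first exact: (fair_sched_prefix ext p0Y I0).
  by have [/YL tL en] := fair_sched_Y ext p0Y I0 ts.
- by move=> t /(fair_sched_Y ext p0Y I0) [].
- exact: fair_sched_fair.
- move=> t; exists (size (rounds L Y C0 Inv p0 s0 t)).
    exact: leq_trans (leq_addl _ _) (size_rounds ext p0Y I0 t).
  by rewrite (mkseq_rounds ext p0Y I0); apply: rounds_Inv.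
Qed.

(** * Guarantees of the algorithm at reachable configurations *)

Section FischerLynchPaterson.
Variables (n f : nat) (A : Alg n) (emb : 'I_n -> 'I_n.+1) (L : {set 'I_n}).
Hypotheses (f_lt : f < n) (card_L : #|L| = n.+1 - f).
Hypothesis solves : solves_with f f A emb.

Local Notation run V s := (foldl (exec L) (init A V) s).
Local Notation runs C s := (foldl (exec L) C s).

Lemma resilient_nonempty (Y : {set 'I_n}) : #|~: Y| <= f -> exists p, p \in Y.
Proof.
move=> cY; have : 0 < #|Y|.
  have := cardsC Y; rewrite card_ord => e.
  by case: #|Y| e => // e; move: f_lt; rewrite -e add0n ltnNge cY.
by case/card_gt0P=> p; exists p.
Qed.

(** [L] leaves out [f - 1] processes only, so one process of [L] may still crash. *)
Lemma card_setCL : #|~: L| < f.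
Proof.
have := cardsC L; rewrite card_ord card_L => e.
have fn : f <= n.+1 by apply/ltnW/ltnW.
by rewrite -(ltn_add2l (n.+1 - f)) e subnK.
Qed.

Lemma card_setCLD1 p : #|~: (L :\ p)| <= f.
Proof.
have := cardsC (L :\ p).
rewrite -(cardsC L) (cardsD1 p L) [(p \in L) + _]addnC -addnA => /addnI ->.
by apply: leq_trans _ card_setCL; rewrite -[X in _ <= X]add1n leq_add2r leq_b1.
Qed.

Lemma schedule_solves V Y sigma T :
  #|~: Y| <= f ->
  (forall t, (sigma t).1 \in L /\ enabled L (run V (mkseq sigma t)) (sigma t)) ->
  (forall t, T <= t -> (sigma t).1 \in Y) ->
  (forall a t, a.1 \in Y -> enabled L (run V (mkseq sigma t)) a ->
     exists2 t', t <= t' & sigma t' = a) ->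
  solves_in_run (scheduled_run A L Y V sigma T).
Proof.
move=> cY ok sY fair; apply: solves; last first.
  exists (~: Y); split=> // p /=; rewrite inE; split=> [pY|[t]].
    by exists T; rewrite ltnn inE.
  by case: ifP => _; rewrite inE.
apply: scheduled_is_run => //; first exact: ltnW.
  by move=> t; have [] := ok t.
by move=> t; have [] := ok t.
Qed.

(** Crashing everything outside [Y] at the end of [s0] and continuing fairly within [Y] gives an
    admissible run, so the guarantees of [solves] can be read off at the configurations reached by
    [s0]. *)
Lemma extension_solves V (Y : {set 'I_n}) s0 :
  Y \subset L -> #|~: Y| <= f -> valid L L (init A V) s0 ->
  exists sigma,
    [/\ forall t, t <= size s0 -> mkseq sigma t = take t s0,
        forall t, size s0 <= t -> exists2 r, mkseq sigma t = s0 ++ r & valid L Y (run V s0) r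
      & solves_in_run (scheduled_run A L Y V sigma (size s0))].
Proof.
move=> YL cY va; have [p0 p0Y] := resilient_nonempty cY.
have [|sigma [e ok sY fair _]] :=
    @fair_schedule_exists n A L Y (init A V) (fun=> True) p0 s0 _ YL p0Y va I.
  by move=> s a _ aY en; exists [:: a]; rewrite /= aY en inE eqxx.
exists sigma; split; last exact: schedule_solves.
  by move=> t ts; rewrite -[in RHS]e -map_take take_iota (minn_idPl ts).
move=> t /subnK <-; elim: (t - _) => [|d [r er vr]].
  by exists [::]; rewrite // cats0.
exists (rcons r (sigma (d + size s0))); first by rewrite addSn mkseqS er rcons_cat.
rewrite valid_rcons vr sY ?leq_addl //=.
by have [_] := ok (d + size s0); rewrite er foldl_cat.
Qed.

Definition good (C : conf A) : Prop :=
  exists V s, valid L L (init A V) s /\ C = run V s.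

Lemma good_init V : good (init A V).
Proof. by exists V, [::]. Qed.

Lemma good_runs C s : good C -> valid L L C s -> good (runs C s).
Proof.
move=> [V [s0 [va ->]]] vs; exists V, (s0 ++ s).
by rewrite valid_cat va vs foldl_cat.
Qed.

Lemma good_exec C a : good C -> a.1 \in L -> enabled L C a -> good (exec L C a).
Proof. by move=> gC aL en; apply: (@good_runs C [:: a]); rewrite //= aL en. Qed.

Lemma full_extension V s0 : valid L L (init A V) s0 ->
  exists sigma,
    (forall t, t <= size s0 -> mkseq sigma t = take t s0) /\
    solves_in_run (scheduled_run A L L V sigma (size s0)).
Proof.
move=> va.
have [sigma [pre _ so]] := extension_solves (subxx L) (ltnW card_setCL) va.
by exists sigma.
Qed.

Lemma agreement C v w : good C -> decided C v -> decided C w -> v = w.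
Proof.
move=> [V [s [va ->]]] [p pv] [q qw].
have [sigma [pre [_ [_ [agr _]]]]] := full_extension va.
by apply: (agr p q (size s) (size s)); rewrite /= /conf_at pre // take_size.
Qed.

Lemma validity V s v : valid L L (init A V) s -> decided (run V s) v -> ConsP V v.
Proof.
move=> va [p pv]; have [sigma [pre [_ [_ [_ valP]]]]] := full_extension va.
by apply: (valP p (size s)); rewrite /= /conf_at pre // take_size.
Qed.

Lemma persistence C s v : good C -> valid L L C s -> decided C v -> decided (runs C s) v.
Proof.
move=> [V [s0 [va ->]]] vs [p pv]; exists p.
have va' : valid L L (init A V) (s0 ++ s) by rewrite valid_cat va.
have [sigma [pre [_ [irr _]]]] := full_extension va'.
have := irr p (size s0) v; rewrite /= /conf_at pre ?size_cat ?leq_addr //.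
rewrite take_size_cat // => /(_ pv (size (s0 ++ s))).
by rewrite size_cat leq_addr pre ?size_cat // -size_cat take_size foldl_cat; apply.
Qed.

(** The crash still allowed in [L] is spent on [p]: the others cannot wait for it and must
    decide. *)
Lemma silent_termination C p : good C -> exists r q v,
  [/\ valid L (L :\ p) C r, q != p & adec A (lst (runs C r q)) = Some v].
Proof.
move=> [V [s0 [va ->]]].
have [q qY] := resilient_nonempty (card_setCLD1 p).
have [sigma [_ suf [term [irr _]]]] :=
  extension_solves (subD1set L p) (card_setCLD1 p) va.
have [|t [v tv]] := term q; first exact/correctE.
(* The decision may fall within [s0]; irrevocability moves it to a time not before the end of [s0],
   where the schedule splits as [s0 ++ r]. *)
have := irr q t v tv _ (leq_maxl t (size s0)).
have [r er vr] := suf _ (leq_maxr t (size s0)).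
rewrite /= /conf_at er foldl_cat => qv; exists r, q, v; split=> //.
by move: qY; rewrite in_setD1 => /andP[].
Qed.

(** * Valency and the run without decision *)

Definition reaches (C : conf A) (v : bool) : Prop :=
  exists2 r, valid L L C r & decided (runs C r) v.

Definition bivalent (C : conf A) : Prop := forall v, reaches C v.

Lemma bivalentP C v : reaches C v -> reaches C (~~ v) -> bivalent C.
Proof. by case: v => r1 r2 [|]. Qed.

(** Consequently no process has decided in a bivalent reachable configuration. *)
Lemma reaches_decided C v w : good C -> decided C v -> reaches C w -> v = w.
Proof.
move=> gC dv [r vr dw]; apply: agreement dw; first exact: good_runs.
exact: persistence.
Qed.

Lemma reaches_exec C a v : a.1 \in L -> enabled L C a -> reaches (exec L C a) v -> reaches C v.
Proof. by move=> aL en [r vr d]; exists (a :: r); rewrite //= aL en. Qed.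

Lemma sim_reaches p C C' r q v : sim p C C' -> valid L (L :\ p) C r -> q != p ->
  adec A (lst (runs C r q)) = Some v -> reaches C v /\ reaches C' v.
Proof.
move=> si vr qp d; have [vr' [eqr _]] := sim_valid si vr.
split; exists r; try exact: valid_sub (subD1set L p) _; first by exists q.
by exists q; rewrite -eqr.
Qed.

(** Interpolates from all inputs false to all inputs true, changing one process at a time. A
    schedule in which that process is silent decides alike on both sides, so without bivalence
    reachability of [false] would propagate up to all inputs true, against validity. *)
Lemma bivalent_init : exists V, bivalent (init A V).
Proof.
apply: NNPP => none; pose Vs i := fun j : 'I_n => j < i.
have all_false i : i <= n -> reaches (init A (Vs i)) false.
  elim: i => [_|i IH lt].
    have [p _] := resilient_nonempty (ltnW card_setCL).
    have [r [q [v [vr _ d]]]] := silent_termination p (good_init (Vs 0)).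
    have vr' := valid_sub (subD1set L p) vr.
    have dv : decided (run (Vs 0) r) v by exists q.
    have v0 : v = false by apply: (validity vr' dv).
    by rewrite -v0; exists r.
  pose p := Ordinal lt.
  have si : sim p (init A (Vs i)) (init A (Vs i.+1)).
    split=> [q qp|q]; last by exists [::].
    rewrite /init /Vs ltnS [q <= i]leq_eqVlt; case: eqP => // e.
    by case/eqP: qp; apply: val_inj.
  have [r [q [v [vr qp d]]]] := silent_termination p (good_init (Vs i)).
  have [r1 r2] := sim_reaches si vr qp d.
  (* If the common decision is [false], it passes to [Vs i.+1]; if it is [true], then [Vs i] reaches
     both values. *)
  case: v r1 r2 {d} => // r1 _; case: none; exists (Vs i).
  exact: bivalentP r1 (IH (ltnW lt)).
have [r vr d] := all_false n (leqnn n).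
by have : false = true by apply: (validity vr d) => i; apply: ltn_ord.
Qed.

(* Induction along a schedule [s] that decides the opposite of [v]: performing [a] one step
   later on [s] cannot change the valency without either passing through a bivalent
   configuration or contradicting a decision taken while the process of [a] is silent. *)
Lemma bivalent_along a v s C : good C -> a.1 \in L -> enabled L C a -> valid L L C s ->
  reaches (exec L C a) v -> decided (runs C s) (~~ v) ->
  exists s', [/\ valid L L C s', a \in s' & bivalent (runs C s')].
Proof.
move=> + aL; elim: s C => [|b s IH] C gC en.
  move=> _ rv dv; exists [:: a]; rewrite /= aL en inE eqxx; split=> //.
  apply: bivalentP rv _; exists [::] => //.
  by apply: (@persistence C [:: a]); rewrite //= aL en.
move=> /= /and3P[bL enb vs] rv dv.
have now : reaches (exec L C a) (~~ v) ->
    exists s', [/\ valid L L C s', a \in s' & bivalent (runs C s')].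
  move=> rnv; exists [:: a]; rewrite /= aL en inE eqxx; split=> //.
  exact: bivalentP rv rnv.
have [ba|ba] := eqVneq b a.
  by subst b; apply: now; exists s.
have en1 := enabled_exec en ba; have g1 := good_exec gC bL enb.
have later : reaches (exec L (exec L C b) a) v ->
    exists s', [/\ valid L L C s', a \in s' & bivalent (runs C s')].
  move=> r1; have [s' [v' as' bi]] := IH _ g1 en1 vs r1 dv.
  by exists (b :: s'); rewrite /= bL enb inE as' orbT.
have [r [q [w [vr qp d]]]] := silent_termination a.1 (good_exec g1 aL en1).
(* For distinct processes [a] and [b] commute, so a value [w] reached after [b] then [a] is also
   reached from [exec L C a]. If [w] is [v], induct past [b]; otherwise [exec L C a] is bivalent. *)
have [eab|ab] := eqVneq a.1 b.1; last first.
  have rw : reaches (exec L (exec L C b) a) w.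
    by exists r; [exact: valid_sub (subD1set L a.1) vr | exists q].
  have [e|ne] := eqVneq w v; first by apply: later; rewrite -e.
  apply: now; apply: (reaches_exec bL); first by apply: enabled_exec; rewrite // eq_sym.
  by rewrite (exec_comm en enb ab); case: w v ne rw {d later rv dv IH} => [] [].
(* For a common process, a deciding schedule from [C] without that process applies unchanged after
   [a] and after [b] then [a], so both configurations reach the same [w]. *)
have {r q w vr qp d} [r [q [w [vr qp d]]]] := silent_termination a.1 gC.
have si1 := sim_exec_self L C a.
have si2 : sim a.1 C (exec L (exec L C b) a).
  by apply: sim_trans (sim_exec_self L _ a); rewrite eab; apply: sim_exec_self.
have [_ rw1] := sim_reaches si1 vr qp d; have [_ rw2] := sim_reaches si2 vr qp d.
have [e|ne] := eqVneq w v; first by apply: later; rewrite -e.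
by apply: now; case: w v ne rw1 {rw2 d later rv dv IH} => [] [].
Qed.

(** Some value [v] is reached after [a], and bivalence of [C] supplies a schedule deciding the
    opposite, along which [bivalent_along] works. *)
Lemma bivalent_extend C a : good C -> bivalent C -> a.1 \in L -> enabled L C a ->
  exists s', [/\ valid L L C s', a \in s' & bivalent (runs C s')].
Proof.
move=> gC bi aL en.
have [r [q [v [vr _ d]]]] := silent_termination a.1 (good_exec gC aL en).
have [s vs ds] := bi (~~ v); apply: bivalent_along vs _ ds => //.
by exists r; [exact: valid_sub (subD1set L a.1) vr | exists q].
Qed.

Lemma no_resilient_solution : False.
Proof.
have [V bi] := bivalent_init.
have [p pL] := resilient_nonempty (ltnW card_setCL).
pose Inv s := valid L L (init A V) s /\ bivalent (run V s).
have [||sigma [_ ok sY fair inv]] :=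
    @fair_schedule_exists n A L L (init A V) Inv p [::] _ (subxx L) pL isT _.
- move=> s a [vs bs] aL en.
  have gs : good (run V s) by exists V, s.
  have [s' [vs' as' bs']] := bivalent_extend gs bs aL en.
  by exists s'; split=> //; rewrite /Inv valid_cat vs vs' foldl_cat.
- by [].
have [term [irr _]] := schedule_solves (ltnW card_setCL) ok sY fair.
have [|t [d td]] := term p; first exact/correctE.
(* Bivalence recurs at arbitrarily late times, and irrevocability carries the decision to such a
   time. *)
have [t' tt' [vt' bt']] := inv t.
have gt' : good (run V (mkseq sigma t')) by exists V, (mkseq sigma t').
have dt' : decided (run V (mkseq sigma t')) d by exists p; apply: irr td _ tt'.
by have := reaches_decided gt' dt' (bt' (~~ d)); case: d {td dt'}.
Qed.

End FischerLynchPaterson.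

Theorem mainTheorem16 (n f : nat) :
  1 <= f -> f <= n - 1 -> ~ Cons_Creducible n f n.+1 f.
Proof.
move=> f_gt0 f_le [A [emb [_ solves]]].
have n_gt0 : 0 < n by case: n f_le {A emb solves} => //; case: f f_gt0.
have f_lt : f < n by rewrite -(subnK n_gt0) addn1 ltnS.
(* Here [1 <= f] enters: it leaves room for [n.+1 - f] processes among the [n] present, and [L]
   consists of the first of them. *)
have le_kn : n.+1 - f <= n by rewrite leq_subLR -add1n leq_add2r.
pose L := [set widen_ord le_kn i | i in [set: 'I_(n.+1 - f)]].
have widen_inj : injective (widen_ord le_kn).
  by move=> i j /(congr1 val) /= /val_inj.
have card_L : #|L| = n.+1 - f by rewrite card_imset // cardsT card_ord.
exact: no_resilient_solution f_lt card_L solves.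
Qed.
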